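(* Let $X\in\mathrm{NU}$ be infinite-dimensional. Then $o(T_{NU}(X))\ge\omega+1$.
   Context: Spaces. $2^{\mathbb N}$ is the Cantor space of infinite binary sequences, and $C(2^{\mathbb N})$ is the Banach space of continuous real-valued functions on it with the supremum norm. $\mathrm{SB}$ is the set of all closed linear subspaces of $C(2^{\mathbb N})$ (with the Effros Borel structure), and $\mathrm{NU}$ is the set of $X\in\mathrm{SB}$ that do not contain an isomorphic copy of $C(2^{\mathbb N})$. Fix Borel maps $d_n:\mathrm{SB}\to C(2^{\mathbb N})$, $n\in\mathbb N$, such that for every $X\in\mathrm{SB}$ the set $\{d_n(X): n\in\mathbb N\}$ is a dense subset of $X$. Haar basis. Let $\mathcal O\subseteq 2^{<\mathbb N}$ consist of the empty string together with all finite binary strings ending in $0$. Enumerate $\mathcal O$ as $t_0,t_1,t_2,\ldots$ by increasing length and, among strings of equal length, lexicographically (at the first index where they differ, the string with entry $0$ comes first); thus $t_0=\varnothing$, $t_1=(0)$, $t_2=(00)$, $t_3=(10)$, $t_4=(000)$, etc. Let $V_n=\{\alpha\in 2^{\mathbb N}: t_n \text{ is an initial segment of }\alpha\}$ and $f_{t_n}=\chi_{V_n}\in C(2^{\mathbb N})$. The sequence $(f_{t_n})_{n\ge 0}$ is a normalized monotone Schauder basis of $C(2^{\mathbb N})$, called the Haar basis. Equivalence. For $C\in[1,\infty)$, finite sequences $(x_n)_{n=0}^{m-1}$ in a Banach space $X$ and $(y_n)_{n=0}^{m-1}$ in a Banach space $Y$ are $C$-equivalent if for all real $a_0,\dots,a_{m-1}$,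 $$\tfrac1C\Big\|\sum_{n=0}^{m-1} a_nx_n\Big\|\le\Big\|\sum_{n=0}^{m-1} a_ny_n\Big\|\le C\Big\|\sum_{n=0}^{m-1} a_nx_n\Big\|.$$ Trees. A tree on a set $A$ is a set $T$ of finite sequences from $A$ closed under initial segments; it is well-founded if there is no infinite sequence in $A$ all of whose finite initial segments belong to $T$. Derivatives: $T^{(0)}=T$; $T^{(\xi+1)}=\{t\in T^{(\xi)}: \text{some } s\in T^{(\xi)} \text{ properly extends } t\}$; $T^{(\lambda)}=\bigcap_{\xi<\lambda}T^{(\xi)}$ for limit $\lambda$. For well-founded $T$, the order $o(T)$ is the least ordinal $\xi$ with $T^{(\xi)}=\varnothing$. Non-universal tree. For $X\in\mathrm{SB}$, $T_{NU}(X)=T_{NU}(X,C(2^{\mathbb N}),(f_{t_n}))$ is the tree on $\mathbb N$ consisting of the empty sequence and all sequences $(k,\ell_0,\dots,\ell_{m-1})$ with $k\ge1$, $m\ge0$, such that $(d_{\ell_n}(X))_{n=0}^{m-1}$ is $k$-equivalent to $(f_{t_n})_{n=0}^{m-1}$ (for $m=0$ the condition is vacuous). It is well-founded whenever $X\in\mathrm{NU}$ (known fact), so $o(T_{NU}(X))$ is defined. *)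

(* Defs.v *)
From HB Require Import structures.
From mathcomp Require Import all_boot all_order all_algebra.
From mathcomp Require Import all_classical all_reals all_analysis.
Set Implicit Arguments.
Unset Strict Implicit.
Unset Printing Implicit Defensive.
Import Order.TTheory GRing.Theory Num.Theory.
Import numFieldNormedType.Exports.
Local Open Scope classical_set_scope.
Local Open Scope ring_scope.

(* C(2^N): a fresh name for [continuousType cantor_space R], so that it carries the
   sup-norm topology only. *)
Definition cantorC (R : realType) : Type := continuousType cantor_space R.

Section CantorC.
Variable R : realType.
Implicit Types f g h : cantorC R.

Definition cantorC_fun f : cantor_space -> R := f.

HB.instance Definition _ := Choice.copy (cantorC R) (continuousType cantor_space R).

Definition mk_cantorC (f : cantor_space -> R) (cf : continuous f) : cantorC R :=
  mkcts cf.

Lemma cantorC_continuous f : continuous (cantorC_fun f).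
Proof. exact: cts_fun. Qed.

Lemma cantorCP f g : cantorC_fun f =1 cantorC_fun g -> f = g.
Proof. by move=> fg; apply/continuousEP. Qed.

Lemma cantorC0_subproof : continuous (fun _ : cantor_space => 0 : R).
Proof. by move=> x; exact: cvg_cst. Qed.
Lemma cantorCN_subproof f : continuous (fun x => - cantorC_fun f x).
Proof. by move=> x; apply: cvgN; exact: cantorC_continuous. Qed.
Lemma cantorCD_subproof f g :
  continuous (fun x => cantorC_fun f x + cantorC_fun g x).
Proof. by move=> x; apply: cvgD; exact: cantorC_continuous. Qed.
Lemma cantorCZ_subproof (a : R) f : continuous (fun x => a * cantorC_fun f x).
Proof. by move=> x; apply: cvgMl_tmp; exact: cantorC_continuous. Qed.

Definition cantorC0 := mk_cantorC cantorC0_subproof.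
Definition cantorCN f := mk_cantorC (@cantorCN_subproof f).
Definition cantorCD f g := mk_cantorC (@cantorCD_subproof f g).
Definition cantorCZ a f := mk_cantorC (@cantorCZ_subproof a f).

Lemma cantorCDA : associative cantorCD.
Proof. by move=> f g h; apply: cantorCP => x; exact: addrA. Qed.
Lemma cantorCDC : commutative cantorCD.
Proof. by move=> f g; apply: cantorCP => x; exact: addrC. Qed.
Lemma cantorC0D : left_id cantorC0 cantorCD.
Proof. by move=> f; apply: cantorCP => x; exact: add0r. Qed.
Lemma cantorCND : left_inverse cantorC0 cantorCN cantorCD.
Proof. by move=> f; apply: cantorCP => x; exact: addNr. Qed.

HB.instance Definition _ :=
  GRing.isZmodule.Build (cantorC R) cantorCDA cantorCDC cantorC0D cantorCND.

Lemma cantorCZA a b f : cantorCZ a (cantorCZ b f) = cantorCZ (a * b) f.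
Proof. by apply: cantorCP => x; exact: mulrA. Qed.
Lemma cantorC1Z : left_id 1 cantorCZ.
Proof. by move=> f; apply: cantorCP => x; exact: mul1r. Qed.
Lemma cantorCZDr : right_distributive cantorCZ +%R.
Proof. by move=> a f g; apply: cantorCP => x; exact: mulrDr. Qed.
Lemma cantorCZDl f : {morph cantorCZ^~ f : a b / a + b}.
Proof. by move=> a b; apply: cantorCP => x; exact: mulrDl. Qed.

HB.instance Definition _ := GRing.Zmodule_isLmodule.Build R (cantorC R)
  cantorCZA cantorC1Z cantorCZDr cantorCZDl.

Definition cantorC_norm f : R := sup [set `|cantorC_fun f x| | x in setT].

Lemma cantorC_has_sup f : has_sup [set `|cantorC_fun f x| | x in setT].
Proof.
split; first by exists `|cantorC_fun f point|, point.
have : compact [set `|cantorC_fun f x| | x in setT].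
  apply: continuous_compact; last exact: cantor_space_compact.
  apply: continuous_subspaceT => x.
  by apply: cvg_norm; exact: cantorC_continuous.
move=> /compact_bounded[M [_ /(_ (M + 1))]] Mb.
exists (M + 1) => _ [x _ <-].
have /Mb/(_ `|cantorC_fun f x|) : M < M + 1 by rewrite ltrDl.
by move=> /(_ (ex_intro2 _ _ x I erefl)) /=; rewrite normr_id.
Qed.

Lemma cantorC_norm_ub f x : `|cantorC_fun f x| <= cantorC_norm f.
Proof.
by apply: sup_upper_bound; [exact: cantorC_has_sup|exists x].
Qed.

Lemma cantorC_norm_le f (M : R) :
  (forall x, `|cantorC_fun f x| <= M) -> cantorC_norm f <= M.
Proof.
move=> fM; apply: ge_sup; first by case: (cantorC_has_sup f).
by move=> _ [x _ <-].
Qed.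

Lemma cantorC_normD f g :
  cantorC_norm (f + g) <= cantorC_norm f + cantorC_norm g.
Proof.
apply: cantorC_norm_le => x; apply: (le_trans (ler_normD _ _)).
by apply: lerD; exact: cantorC_norm_ub.
Qed.

Lemma cantorC_normZ a f : cantorC_norm (a *: f) = `|a| * cantorC_norm f.
Proof.
have le b g : cantorC_norm (b *: g) <= `|b| * cantorC_norm g.
  apply: cantorC_norm_le => x; rewrite /= normrM.
  by apply: ler_wpM2l => //; exact: cantorC_norm_ub.
apply/eqP; rewrite eq_le le /=.
have [->|a0] := eqVneq a 0.
  rewrite normr0 mul0r; apply: le_trans (cantorC_norm_ub _ point).
  exact: normr_ge0.
have := le a^-1 (a *: f); rewrite scalerA mulVf// scale1r.
by rewrite normfV ler_pdivlMl// normr_gt0.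
Qed.

Lemma cantorC_norm_eq0 f : cantorC_norm f = 0 -> f = 0.
Proof.
move=> f0; apply: cantorCP => x; apply/eqP.
by rewrite -normr_le0 -f0; exact: cantorC_norm_ub.
Qed.

HB.instance Definition _ := Lmodule_isNormed.Build R (cantorC R)
  cantorC_normD cantorC_normZ cantorC_norm_eq0.

End CantorC.

Record SB (R : realType) : Type := MkSB {
  SB_set :> set (cantorC R) ;
  SB_closed : closed SB_set ;
  SB_zero : SB_set 0 ;
  SB_linear : forall (a : R) (f g : cantorC R),
    SB_set f -> SB_set g -> SB_set (a *: f + g) }.

(* The Effros Borel sets: the sigma-algebra generated by the hit sets of the
   open subsets of C(2^N). *)
Definition effros (R : realType) : set (set (SB R)) :=
  <<s [set [set X : SB R | (X : set (cantorC R)) `&` U !=set0]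
      | U in [set U : set (cantorC R) | open U]] >>.

Definition borel_SB_map (R : realType) (phi : SB R -> cantorC R) : Prop :=
  forall B : set (cantorC R), <<s [set U : set (cantorC R) | open U] >> B ->
    effros (phi @^-1` B).

Section BanachSpaces.
Variables (R : realType).

(* [T] is a linear homeomorphism of [W] onto its range, which lies in [X]. *)
Definition contains_copy (V W : normedModType R) (X : set V) : Prop :=
  exists (T : {linear W -> V}) (c : R),
    [/\ 0 < c, forall w, X (T w) &
        forall w, c^-1 * `|w| <= `|T w| <= c * `|w|].

Definition finite_dimensional (V : normedModType R) (X : set V) : Prop :=
  exists (n : nat) (e : 'I_n -> V),
    X = [set \sum_(i < n) a i *: e i | a in [set: 'I_n -> R]].

Definition equivalent_seqs (V W : normedModType R) (C : R) (m : nat)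
    (x : 'I_m -> V) (y : 'I_m -> W) : Prop :=
  forall a : 'I_m -> R,
    C^-1 * `|\sum_(i < m) a i *: x i| <= `|\sum_(i < m) a i *: y i|
      <= C * `|\sum_(i < m) a i *: x i|.

End BanachSpaces.

Definition NU (R : realType) : set (SB R) :=
  [set X : SB R | ~ contains_copy (cantorC R) (X : set (cantorC R))].

(* All binary strings of length [n], in lexicographic order, with
   [false] standing for 0 and [true] for 1. *)
Fixpoint bin_strings (n : nat) : seq (seq bool) :=
  if n is n'.+1 then
    [seq false :: s | s <- bin_strings n'] ++ [seq true :: s | s <- bin_strings n']
  else [:: [::]].

(* The empty string and the strings ending in 0. *)
Definition haar_index : pred (seq bool) := fun s => ~~ last false s.

(* The strings of length at most [n] include at least [n.+1] elements of
   [haar_index], so the default value of [nth] is never reached. *)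
Definition haar_string (n : nat) : seq bool :=
  nth [::] (flatten [seq [seq s <- bin_strings l | haar_index s]
                    | l <- iota 0 n.+1]) n.

Lemma haar_string_first : [seq haar_string n | n <- iota 0 8] =
  [:: [::]; [:: false]; [:: false; false]; [:: true; false];
      [:: false; false; false]; [:: false; true; false];
      [:: true; false; false]; [:: true; true; false]].
Proof. by []. Qed.

Definition cylinder (s : seq bool) : set cantor_space :=
  [set alpha : cantor_space | mkseq (alpha : nat -> bool) (size s) = s].

Section Haar.
Variable R : realType.

Lemma indic_cylinder_continuous (s : seq bool) :
  continuous (\1_(cylinder s) : cantor_space -> R).
Proof.
move=> a; apply: near_cst_continuous.
have nb (n : nat) : \forall b \near a,
    mkseq (b : nat -> bool) n = mkseq (a : nat -> bool) n.
  elim: n => [|n IHn]; first by apply: filterE => b.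
  have bn : \forall b \near a, (b : nat -> bool) n = (a : nat -> bool) n.
    have /= := @proj_continuous nat (fun=> bool) n a [set x | x = a n].
    apply; exact: discrete_set1.
  near=> b; rewrite !mkseqS; congr rcons; last by near: b.
  by near: b.
near=> b; rewrite !indicE; congr (_%:R).
have -> // : (b \in cylinder s) = (a \in cylinder s).
apply/idP/idP => /set_mem H; apply/mem_set; rewrite /cylinder/= -[RHS]H.
  by apply/esym; near: b; exact: nb.
by near: b; exact: nb.
Unshelve. all: by end_near. Qed.

Definition haar (n : nat) : cantorC R :=
  mk_cantorC (@indic_cylinder_continuous (haar_string n)).

End Haar.

(* Ordinal notations: [OSup i0 f] denotes the supremum of the family [f], which
   [i0] witnesses to be nonempty.  All limit ordinals are of this form; when
   the supremum is a maximum, [OSup i0 f] is another notation for that maximum.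
   Several notations may denote the same ordinal, and [ole] is the induced
   preorder: equality of ordinals is [ole] in both directions. *)
Inductive Ord : Type :=
| OZero
| OSucc of Ord
| OSup (I : Type) of I & (I -> Ord).

(* [above (ole a) b] is [a < b]:  nothing is below 0,  a < b + 1 iff a <= b,
   and a < sup f iff a < f i for some i. *)
Fixpoint above (le_a : Ord -> Prop) (b : Ord) : Prop :=
  match b with
  | OZero => False
  | OSucc b' => le_a b'
  | OSup _ _ f => exists i, above le_a (f i)
  end.

Fixpoint ole (a : Ord) : Ord -> Prop :=
  match a with
  | OZero => fun=> True
  | OSucc a' => above (ole a')
  | OSup _ _ f => fun b => forall i, ole (f i) b
  end.

Fixpoint ofin (n : nat) : Ord := if n is n'.+1 then OSucc (ofin n') else OZero.

Definition oomega : Ord := OSup 0%N ofin.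

Section Trees.
Variable A : eqType.
Implicit Types T : set (seq A).

Definition derived_tree T : set (seq A) :=
  [set t | T t /\ exists2 s, T s & prefix t s /\ s <> t].

(* The derivatives decrease with the exponent, so the [OSup] clause is correct
   also when the supremum is a maximum. *)
Fixpoint tree_derivative T (xi : Ord) : set (seq A) :=
  match xi with
  | OZero => T
  | OSucc xi' => derived_tree (tree_derivative T xi')
  | OSup _ _ f => \bigcap_i tree_derivative T (f i)
  end.

Definition is_tree_order T (xi : Ord) : Prop :=
  tree_derivative T xi = set0 /\
  forall eta, tree_derivative T eta = set0 -> ole xi eta.

(* A notation for o(T); the value 0 when no derivative of [T] is empty, that is
   when [T] is not well-founded, is junk. *)
Definition tree_order T : Ord :=
  if pselect (exists xi, is_tree_order T xi) is left ex
  then projT1 (cid ex) else OZero.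

End Trees.

(* [x] stands for the chosen dense sequence (d_n(X))_n and [e] for the basis. *)
Definition NU_tree (R : realType) (V Z : normedModType R)
    (x : nat -> V) (e : nat -> Z) : set (seq nat) :=
  [set s | if s is k :: l then
             (1 <= k)%N /\
             @equivalent_seqs R V Z k%:R (size l)
               (fun i => x (nth 0%N l i)) (fun i => e i)
           else True].

Definition T_NU (R : realType) (d : nat -> SB R -> cantorC R) (X : SB R) :
    set (seq nat) :=
  NU_tree (fun n => d n X) (@haar R).

(* Main.v *)
From HB Require Import structures.
Require Import Defs.
From mathcomp Require Import all_boot all_order all_algebra.
From mathcomp Require Import all_classical all_reals all_analysis.
From mathcomp Require Import ring lra.
Set Implicit Arguments.
Unset Strict Implicit.
Unset Printing Implicit Defensive.
Import Order.TTheory GRing.Theory Num.Theory.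
Import numFieldNormedType.Exports.
Local Open Scope classical_set_scope.
Local Open Scope ring_scope.

(** Two facts about the tree T = T_NU(X) give the bound.

    The root survives all finite derivatives, hence lies in the omega-th one.
    For this it is enough that T has nodes of every length
    ([root_in_omega_derivative]).  An infinite-dimensional X contains m linearly
    independent vectors for each m; linear independence is an open condition
    ([lin_indep_perturb]), so by density some m vectors d_l(X) are linearly
    independent; and any two linearly independent families of the same finite
    length are k-equivalent for a large k, by compactness of the unit sphere of
    R^m ([lin_indep_equivalent]).  The Haar functions are linearly independent
    ([haar_lin_indep]), which yields a node (k, l_0, ..., l_(m-1)).

    The order of T really exists, so that it is not the default value: T is well
    founded.  An infinite branch (k, l_0, l_1, ...) makes the whole sequence
    (d_(l_n)(X)) k-equivalent to the Haar system.  The map sending the n-th Haar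
    function to d_(l_n)(X) is then bounded above and below on the span of the
    Haar functions, which is dense ([haar_dense]); it extends to an isomorphism
    of C(2^N) into the closed set X ([bounded_below_extension]), contradicting
    that X is in NU.

    For a well-founded tree the rank r of the root satisfies: the root lies in
    the derivative of exponent xi iff xi <= r ([rank_exists]).  Consequently
    o(T) = r + 1, and o(T) exceeds every xi whose derivative contains the root
    ([tree_order_gt]); here xi is omega. *)

(** * Ordinal notations *)

Lemma above_mono (P Q : Ord -> Prop) (b : Ord) :
  (forall c, P c -> Q c) -> above P b -> above Q b.
Proof.
move=> PQ; elim: b => [//|b _|I i0 f IH] /=; first exact: PQ.
by case=> i /IH ?; exists i.
Qed.

Lemma ole_trans (b a c : Ord) : ole a b -> ole b c -> ole a c.
Proof.
elim: a b c => [//|a IHa|I i0 f IHf] b c /=; last first.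
  by move=> fb bc i; apply: IHf (fb i) bc.
elim: b => [//|b _|J j0 g IHg] /=; last by case=> j /IHg gj /(_ j).
by move=> ab; apply: above_mono => d; exact: IHa.
Qed.

Lemma olt_irr (a : Ord) : ~ above (ole a) a.
Proof.
elim: a => [//|//|I i0 f IHf] /= [i ffi]; apply: (IHf i).
by apply: above_mono ffi => c; exact.
Qed.

Lemma oltW (a b : Ord) : above (ole a) b -> ole a b.
Proof.
elim: a b => [//|a IHa|I i0 f IHf] b /=; first exact: above_mono.
by move=> fb i; apply: IHf; apply: above_mono fb => c; exact.
Qed.

(** Comparability is proved by induction on [a] alone: the case of a successor
    asks for the same dichotomy with the roles of the two ordinals exchanged,
    which follows from the induction hypothesis by induction on [b]. *)
Lemma ole_olt_total (a b : Ord) : ole a b \/ above (ole b) a.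
Proof.
elim: a b => [|a IHa|I i0 f IHf] b /=; first by left.
- elim: b => [|b _|J j0 g IHg] /=; first by right.
    by have [|] := IHa b; [left|right].
  have [[j ag]|nag] := pselect (exists j, above (ole a) (g j)).
    by left; exists j.
  by right=> j; have [ag|//] := IHg j; case: nag; exists j.
- have [[i bf]|nbf] := pselect (exists i, above (ole b) (f i)).
    by right; exists i.
  by left=> i; have [//|bf] := IHf i b; case: nbf; exists i.
Qed.

(** * Trees *)

Definition prefix_closed (A : eqType) (T : set (seq A)) :=
  forall s t, prefix s t -> T t -> T s.

Definition extends_in (A : eqType) (T : set (seq A)) (s t : seq A) : Prop :=
  T s /\ (prefix t s /\ s <> t).

Lemma tree_derivative_prefix_closed (A : eqType) (T : set (seq A)) (xi : Ord) :
  prefix_closed T -> prefix_closed (tree_derivative T xi).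
Proof.
move=> Tp; elim: xi => [//|xi IHxi|I i0 f IHf] s t st /=; last first.
  by move=> Tt i _; exact: IHf st (Tt i Logic.I).
case=> Tt [u Tu [tu ut]]; split; first exact: IHxi st Tt.
exists u => //; split; first exact: prefix_trans st tu.
move=> us; apply: ut; rewrite us in tu *.
have /eqP ts : size t == size s.
  by rewrite eqn_leq (size_prefix tu) (size_prefix st).
by move: tu; rewrite prefixE ts take_size => /eqP.
Qed.

Lemma tree_derivative_sub (A : eqType) (T : set (seq A)) (xi : Ord) :
  tree_derivative T xi `<=` T.
Proof.
elim: xi => [//|xi IHxi|I i0 f IHf] t /=; first by case=> /IHxi.
by move=> /(_ i0 Logic.I); exact: IHf.
Qed.

(** The value [r] is the rank of [t], the supremum of rank(s) + 1 over the proper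
    extensions [s] of [t] in the tree.  The family is indexed by all sequences,
    with the value 0 at those which are not such extensions, so that the index
    type does not depend on [t] and is inhabited. *)
Lemma rank_exists (A : eqType) (T : set (seq A)) (t : seq A) :
  Acc (extends_in T) t ->
  exists r, forall xi, tree_derivative T xi t <-> T t /\ ole xi r.
Proof.
elim=> {}t _ IH.
have /choice[r rE] s : exists r, extends_in T s t ->
    forall xi, tree_derivative T xi s <-> T s /\ ole xi r.
  have [/IH[r rE]|nst] := pselect (extends_in T s t); first by exists r.
  by exists OZero.
pose g s := if pselect (extends_in T s t) then OSucc (r s) else OZero.
exists (OSup [::] g); elim=> [|xi IHxi|I i0 f IHf] /=.
- by split=> [|[]].
- split.
    case=> /IHxi[Tt xir] [s sxi st]; split=> //; exists s; rewrite /g.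
    have Rst : extends_in T s t.
      by split; [exact: tree_derivative_sub sxi|].
    by case: pselect => //= _; apply (rE s Rst xi).
  case=> Tt [s]; rewrite /g; case: pselect => //= Rst xir.
  split.
    apply/IHxi; split=> //; apply: oltW; exists s.
    by rewrite /g; case: pselect.
  exists s; last by case: Rst.
  by apply/(rE s Rst); split=> //; case: Rst.
- split=> [Tf|[Tt fr] i _]; last by apply/IHf.
  split; first by have /IHf[] := Tf i0 Logic.I.
  by move=> i; have /IHf[] := Tf i Logic.I.
Qed.

Definition infinite_branch (T : set (seq nat)) (b : nat -> nat) :=
  forall n, T (mkseq b n).

(** A root that is not accessible starts an infinite chain of proper extensions;
    the n-th one has length at least n, and the chain converges to a branch. *)
Lemma acc_of_no_branch (T : set (seq nat)) :
  prefix_closed T -> ~ (exists b, infinite_branch T b) ->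
  Acc (extends_in T) [::].
Proof.
move=> Tp nb; have [//|nacc] := pselect (Acc (extends_in T) [::]).
pose B := {t | ~ Acc (extends_in T) t}.
have next (t : B) : exists s : B, extends_in T (sval s) (sval t).
  have [//|ns] := pselect (exists s : B, extends_in T (sval s) (sval t)).
  case: (svalP t); constructor=> s st.
  have [//|nas] := pselect (Acc (extends_in T) s).
  by case: ns; exists (exist _ s nas).
have [nx nxP] := choice next.
pose u n := sval (iter n nx (exist _ [::] nacc)).
have uS n : extends_in T (u n.+1) (u n) by exact: nxP.
have usz n : (n <= size (u n))%N.
  elim: n => // n IH; apply: leq_ltn_trans IH _.
  have [_ [uu neq]] := uS n; rewrite ltn_neqAle size_prefix// andbT.
  apply/eqP => sz; apply: neq; move: uu.
  by rewrite prefixE sz take_size => /eqP.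
case: nb; exists (fun n => nth 0%N (u n.+1) n) => n.
suff -> : mkseq (fun n => nth 0%N (u n.+1) n) n = take n (u n.+1).
  by apply: Tp (proj1 (uS n)); exact: prefix_take.
elim: n => [|n IH]; first by rewrite take0.
have [_ [/prefixP[v uE] _]] := uS n.+1.
by rewrite mkseqS IH -take_nth ?uE ?takel_cat//; exact: (usz n.+1).
Qed.

(** If r is the rank of the root, then r + 1 is the order of the tree.  As
    [tree_order] is an arbitrarily chosen notation for the order, only the
    emptiness of its derivative can be used: no exponent up to r has that
    property, as the root survives. *)
Lemma tree_order_gt (T : set (seq nat)) (xi : Ord) :
  prefix_closed T -> ~ (exists b, infinite_branch T b) ->
  tree_derivative T xi [::] -> ole (OSucc xi) (tree_order T).
Proof.
move=> Tp nb Txi.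
have [r rE] := rank_exists (acc_of_no_branch Tp nb).
have [T0 xir] := (rE xi).1 Txi.
have gt_r eta : tree_derivative T eta = set0 -> above (ole r) eta.
  move=> Te; have [er|//] := ole_olt_total eta r.
  by have : tree_derivative T eta [::] by [apply/rE]; rewrite Te.
have ord_r : is_tree_order T (OSucc r).
  split; last exact: gt_r.
  apply/seteqP; split=> // t [/= Tt [s Ts [ts st]]].
  have : tree_derivative T (OSucc r) [::].
    have p0 : prefix [::] t by exact: prefix0s.
    split; first exact: (tree_derivative_prefix_closed (xi := r) Tp p0 Tt).
    exists s => //; split=> [|s0]; first exact: prefix0s.
    by apply: st; move: ts; rewrite s0 prefixs0 => /eqP.
  by case/rE => _ /olt_irr.
rewrite /tree_order; case: pselect => [ex|]; last by case; exists (OSucc r).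
have [To _] := projT2 (cid ex).
(* The root lies in the derivative of exponent xi, so xi <= r. *)
by apply: above_mono (gt_r _ To) => c; exact: ole_trans.
Qed.

(** A node of length n has n + 1 initial segments; the one obtained by removing
    m entries survives m derivatives. *)
Lemma root_in_omega_derivative (T : set (seq nat)) :
  prefix_closed T -> (forall n, exists2 t, T t & size t = n) ->
  tree_derivative T oomega [::].
Proof.
move=> Tp Tn n _.
suff H m t : T t -> (m <= size t)%N ->
    tree_derivative T (ofin m) (take (size t - m) t).
  by have [t Tt tn] := Tn n; have := H n t Tt; rewrite tn subnn take0; apply.
move=> Tt; elim: m => [_|m IH mt]; first by rewrite subn0 take_size.
have lt : (size t - m.+1 < size t - m)%N by rewrite ltn_sub2l.
have pr : prefix (take (size t - m.+1) t) (take (size t - m) t).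
  by rewrite prefixE size_takel ?leq_subr// -take_min (minn_idPl (ltnW lt)).
split.
  exact: (tree_derivative_prefix_closed (xi := ofin m) Tp pr (IH (ltnW mt))).
exists (take (size t - m) t); first exact: IH (ltnW mt).
split=> // /(congr1 size).
by rewrite !size_takel ?leq_subr// => E; move: lt; rewrite E ltnn.
Qed.

(** * Finite linear combinations *)

(** Finitely supported coefficient sequences are represented by polynomials:
    these form a vector space, and the linear combination is then a linear map
    on a single space, with no bound on the support to carry along. *)
Definition comb (R : nzRingType) (V : lmodType R) (e : nat -> V)
    (p : {poly R}) : V :=
  \sum_(i < size p) p`_i *: e i.

Lemma comb_widen (R : nzRingType) (V : lmodType R) (e : nat -> V)
    (p : {poly R}) (n : nat) :
  (size p <= n)%N -> comb e p = \sum_(i < n) p`_i *: e i.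
Proof.
move=> pn; rewrite /comb (big_ord_widen n (fun i => p`_i *: e i) pn).
rewrite [RHS](bigID (fun i : 'I_n => (i < size p)%N))/=.
rewrite [X in _ = _ + X]big1 ?addr0// => i.
by rewrite -leqNgt => /(nth_default 0) ->; rewrite scale0r.
Qed.

Lemma comb_is_linear (R : nzRingType) (V : lmodType R) (e : nat -> V) :
  linear (comb e).
Proof.
move=> a p q; pose n := maxn (maxn (size p) (size q)) (size (a *: p + q)).
rewrite !(@comb_widen _ _ _ _ n) ?leq_max ?leqnn ?orbT//.
rewrite scaler_sumr -big_split/=; apply: eq_bigr => i _.
by rewrite coefD coefZ scalerDl scalerA.
Qed.

HB.instance Definition _ (R : nzRingType) (V : lmodType R) (e : nat -> V) :=
  GRing.isLinear.Build R {poly R} V *:%R (comb e) (comb_is_linear e).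

Definition lin_indep (R : nzRingType) (V : lmodType R) (m : nat)
    (x : 'I_m -> V) :=
  forall a : 'I_m -> R, \sum_(i < m) a i *: x i = 0 -> forall i, a i = 0.

Lemma coord_le_norm (R : realType) (m : nat) (v : 'rV[R]_m) i : `|v 0 i| <= `|v|.
Proof.
rewrite [leRHS]/Num.norm/= mx_normrE.
by apply/bigmax_geP; right; exists (0, i).
Qed.

Lemma norm_lincomb_le (R : realType) (V : normedModType R) (m : nat)
    (x : 'I_m -> V) (v : 'rV[R]_m) :
  `|\sum_(i < m) v 0 i *: x i| <= `|v| * \sum_(i < m) `|x i|.
Proof.
apply: le_trans (ler_norm_sum _ _ _) _; rewrite mulr_sumr; apply: ler_sum => i _.
by rewrite normrZ ler_wpM2r// coord_le_norm.
Qed.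

(** The function v |-> |sum_i v_i x_i| is continuous, and positive on the unit
    sphere of R^m by linear independence; the sphere is compact, so [c] can be
    its minimum there. *)
Lemma lin_indep_lower_bound (R : realType) (V : normedModType R) (m : nat)
    (x : 'I_m -> V) :
  lin_indep x ->
  exists2 c : R, 0 < c &
    forall v : 'rV[R]_m, c * `|v| <= `|\sum_(i < m) v 0 i *: x i|.
Proof.
move=> xi.
pose N (v : 'rV[R]_m) := `|\sum_(i < m) v 0 i *: x i|.
have Ncont : continuous N.
  pose s := \sum_(i < m) `|x i|.
  have s1 : 0 < s + 1 by rewrite ltr_wpDl// sumr_ge0.
  move=> v; apply/(@cvgrPdist_lt _ _ _ (nbhs v)) => e e0; apply/nbhs_ballP.
  exists (e / (s + 1)) => /= [|w]; first by rewrite divr_gt0.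
  rewrite -ball_normE /= => vw; apply: le_lt_trans (ler_dist_dist _ _) _.
  rewrite -sumrB (eq_bigr (fun i => (v - w) 0 i *: x i)); last first.
    by move=> i _; rewrite -scalerBl !mxE.
  apply: le_lt_trans (norm_lincomb_le _ _) _.
  apply: (@le_lt_trans _ _ (`|v - w| * (s + 1))).
    by rewrite ler_wpM2l// lerDl.
  by rewrite -ltr_pdivlMr.
pose S : set 'rV[R]_m := [set v | `|v| = 1].
(* The sphere is empty for m = 0; then every v is zero. *)
have [S0|S0] := pselect (S !=set0); last first.
  exists 1 => // v; have [->|v0] := eqVneq v 0.
    by rewrite normr0 mulr0.
  case: S0; exists (`|v|^-1 *: v).
  by rewrite /S/= normrZ ger0_norm ?invr_ge0// mulVf// normr_eq0.
have Scompact : compact S.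
  apply: bounded_closed_compact.
    exists 1; split=> // M M1 v /= ->; exact: ltW.
  have -> : S = (@Num.norm R 'rV[R]_m) @^-1` [set 1] by [].
  by apply: closed_comp => [v _|]; [exact: norm_continuous|exact: closed_eq].
have [c] := compact_EVT_min S0 Scompact (continuous_subspaceT Ncont).
rewrite inE => cS cmin.
have Nc : 0 < N c.
  rewrite normr_gt0; apply/eqP => sum0; move: cS; rewrite /S/=.
  have -> : c = 0 by apply/rowP => i; rewrite mxE; exact: xi.
  by rewrite normr0 => /esym/eqP; rewrite oner_eq0.
exists (N c) => // v; have [->|v0] := eqVneq v 0.
  by rewrite normr0 mulr0.
have vS : `|v|^-1 *: v \in S.
  by rewrite inE /S/= normrZ ger0_norm ?invr_ge0// mulVf// normr_eq0.
rewrite -ler_pdivlMr ?normr_gt0//; apply: le_trans (cmin _ vS) _.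
rewrite /N (eq_bigr (fun i => `|v|^-1 *: (v 0 i *: x i))); last first.
  by move=> i _; rewrite mxE scalerA.
by rewrite -scaler_sumr normrZ ger0_norm ?invr_ge0// mulrC.
Qed.

(** Both norms |sum_i a_i x_i| and |sum_i a_i y_i| are comparable with the
    maximum of the |a_i|: from below by [lin_indep_lower_bound] and from above by
    the triangle inequality. *)
Lemma lin_indep_equivalent (R : realType) (V W : normedModType R) (m : nat)
    (x : 'I_m -> V) (y : 'I_m -> W) :
  lin_indep x -> lin_indep y ->
  exists2 k : nat, (1 <= k)%N & equivalent_seqs k%:R x y.
Proof.
move=> /lin_indep_lower_bound[c c0 cx] /lin_indep_lower_bound[d d0 dy].
pose sx := \sum_(i < m) `|x i|; pose sy := \sum_(i < m) `|y i|.
have sx0 : 0 <= sx by exact: sumr_ge0.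
have sy0 : 0 <= sy by exact: sumr_ge0.
pose k := (Num.truncn (sx / d + sy / c)).+1.
have kP : sx / d + sy / c <= k%:R.
  by apply/ltW; exact: truncnS_gt.
have k0 : 0 < k%:R :> R by rewrite ltr0n.
exists k => // a; pose v : 'rV[R]_m := \row_i a i.
have -> : \sum_(i < m) a i *: x i = \sum_(i < m) v 0 i *: x i.
  by apply: eq_bigr => i _; rewrite mxE.
have -> : \sum_(i < m) a i *: y i = \sum_(i < m) v 0 i *: y i.
  by apply: eq_bigr => i _; rewrite mxE.
have est (E F : normedModType R) (p : 'I_m -> E) (q : 'I_m -> F) (b : R) :
    0 < b -> (forall w : 'rV[R]_m, b * `|w| <= `|\sum_(i < m) w 0 i *: p i|) ->
    (\sum_(i < m) `|q i|) / b <= k%:R ->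
    `|\sum_(i < m) v 0 i *: q i| <= k%:R * `|\sum_(i < m) v 0 i *: p i|.
  move=> b0 /(_ v) bp bk; apply: le_trans (norm_lincomb_le q v) _.
  apply: le_trans (ler_wpM2r _ bk); last exact: normr_ge0.
  rewrite mulrC -mulrA ler_wpM2l//; first exact: sumr_ge0.
  by rewrite mulrC ler_pdivlMr// mulrC.
apply/andP; split.
  rewrite ler_pdivrMl//; apply: est d0 dy _.
  by apply: le_trans kP; rewrite lerDl divr_ge0// ltW.
by apply: est c0 cx _; apply: le_trans kP; rewrite lerDr divr_ge0// ltW.
Qed.

(** A vanishing combination of the [y i] with coefficients [v] would make
    |sum_i v_i x_i| = |sum_i v_i (x_i - y_i)|, which is at most m |v| times the
    size of the perturbation, smaller than the lower bound c |v|. *)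
Lemma lin_indep_perturb (R : realType) (V : normedModType R) (m : nat)
    (x : 'I_m -> V) :
  lin_indep x ->
  exists2 e : R, 0 < e &
    forall y : 'I_m -> V, (forall i, `|x i - y i| < e) -> lin_indep y.
Proof.
move=> /lin_indep_lower_bound[c c0 cx].
have m1 : 0 < m.+1%:R :> R by rewrite ltr0n.
exists (c / m.+1%:R); first by rewrite divr_gt0.
move=> y xy a sum0; pose v : 'rV[R]_m := \row_i a i.
suff v0 : v = 0.
  by move=> i; have := congr1 (fun w : 'rV[R]_m => w 0 i) v0; rewrite !mxE.
apply/eqP; rewrite -normr_le0 leNgt; apply/negP => vgt0.
have := cx v.
have -> : \sum_(i < m) v 0 i *: x i = \sum_(i < m) v 0 i *: (x i - y i).
  rewrite [RHS](eq_bigr (fun i => v 0 i *: x i - a i *: y i)).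
    by rewrite sumrB sum0 subr0.
  by move=> i _; rewrite scalerBr !mxE.
apply/negP; rewrite -ltNge; apply: le_lt_trans (norm_lincomb_le _ _) _.
rewrite mulrC ltr_pM2r//.
apply: (@le_lt_trans _ _ (\sum_(i < m) c / m.+1%:R)).
  by apply: ler_sum => i _; exact: ltW.
rewrite sumr_const card_ord -[ltLHS]mulr_natr mulrAC ltr_pdivrMr// ltr_pM2l//.
by rewrite ltr_nat.
Qed.

(** If no vector of [X] lies outside the span of the first [m] ones, then [X] is
    that span. *)
Lemma infinite_dim_lin_indep (R : realType) (V : normedModType R) (X : set V) :
  X 0 -> (forall (a : R) f g, X f -> X g -> X (a *: f + g)) ->
  ~ finite_dimensional X ->
  forall m, exists2 x : 'I_m -> V, (forall i, X (x i)) & lin_indep x.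
Proof.
move=> X0 Xlin Xinf; elim=> [|m [x xX xi]].
  by exists (fun=> 0) => [[]|a _ []].
have [v vX vn] : exists2 v, X v &
    forall a : 'I_m -> R, v <> \sum_(i < m) a i *: x i.
  apply: contrapT => nv; apply: Xinf; exists m, x.
  apply/seteqP; split=> [v vX|_ [a _ <-]].
    apply: contrapT => na; apply: nv; exists v => // a va.
    by apply: na; exists a.
  by elim/big_ind : _ => // [f g|i _];
    [rewrite -{2}[f]scale1r; exact: Xlin|rewrite -[_ *: _]addr0; exact: Xlin].
exists (fun i => if unlift ord_max i is Some j then x j else v).
  by move=> i; case: unlift.
move=> a; rewrite big_ord_recr/= unlift_none.
rewrite (eq_bigr (fun i : 'I_m => a (widen_ord (leqnSn m) i) *: x i)); last first.
  move=> i _; have -> : widen_ord (leqnSn m) i = lift ord_max i.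
    by apply/val_inj => /=; rewrite /bump leqNgt ltn_ord.
  by rewrite liftK.
move=> sum0; have am : a ord_max = 0.
  apply/eqP/negPn/negP => am.
  apply: (vn (fun i => - (a ord_max)^-1 * a (widen_ord (leqnSn m) i))).
  move/eqP: sum0; rewrite addr_eq0 => /eqP sumE.
  rewrite (eq_bigr (fun i : 'I_m =>
    - (a ord_max)^-1 *: (a (widen_ord (leqnSn m) i) *: x i))); last first.
    by move=> i _; rewrite scalerA.
  by rewrite -scaler_sumr sumE scalerN scaleNr opprK scalerA mulVf// scale1r.
move: sum0; rewrite am scale0r addr0 => /xi ai i.
case: (unliftP ord_max i) => [j ->|->//].
have -> // : lift ord_max j = widen_ord (leqnSn m) j.
by apply/val_inj => /=; rewrite /bump leqNgt ltn_ord.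
Qed.

(** * Completeness of C(2^N) and extension of operators *)

(** A uniformly Cauchy filter converges pointwise, the convergence is uniform, and
    a uniform limit of continuous functions is continuous. *)
Lemma cantorC_complete (R : realType) (F : set_system (cantorC R)) :
  ProperFilter F -> cauchy F -> cvg F.
Proof.
move=> FF /cauchy_ballP Fc.
pose ev x (f : cantorC R) := cantorC_fun f x.
have near_le (e : R) : 0 < e ->
    \forall f & g \near F, forall x, `|ev x f - ev x g| < e.
  move=> e0; have := Fc e e0; apply: filterS => -[f g].
  rewrite -ball_normE /ball_ /= => fg x.
  exact: le_lt_trans (cantorC_norm_ub (f - g) x) fg.
have evc x : cvg (ev x @ F).
  apply: cauchy_cvg; apply/cauchy_ballP => e e0.
  rewrite near_map2 -ball_normE /=.
  by apply: filterS (near_le e e0) => -[f g] /(_ x).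
pose g x : R := lim (ev x @ F).
(* The limit of the uniform Cauchy estimate in one of the two functions. *)
have near_g (e : R) : 0 < e -> \forall f \near F, forall x, `|ev x f - g x| <= e.
  move=> e0; near=> f => x.
  have : (fun h => `|ev x f - ev x h|) @ F --> `|ev x f - g x|.
    by apply: cvg_norm; apply: cvgB; [exact: cvg_cst|exact: evc].
  move=> /cvgr_to_le; apply.
  have : \forall h \near F, forall x, `|ev x f - ev x h| < e.
    by near: f; apply: nearP_dep; exact: near_le.
  by apply: filterS => h /(_ x)/ltW.
have gc : continuous g.
  move=> x; apply/cvgrPdist_lt => e e0.
  have e3 : 0 < e / 3 by rewrite divr_gt0.
  have [f fg] := filter_ex (near_g _ e3).
  have := @cantorC_continuous R f x.
  move=> /cvgrPdist_lt/(_ _ e3); apply: filterS => y fxy.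
  have -> : g x - g y = - (ev x f - g x) + (ev x f - ev y f) + (ev y f - g y).
    by lra.
  apply: le_lt_trans (ler_normD _ _) _.
  rewrite [ltRHS](_ : e = e / 3 + e / 3 + e / 3); last by field.
  apply: ltr_leD; last exact: fg.
  apply: le_lt_trans (ler_normD _ _) _; rewrite normrN.
  by apply: ler_ltD => //; exact: fg.
apply/cvg_ex; exists (mk_cantorC gc).
apply/cvgrPdist_le => e e0.
apply: filterS (near_g e e0) => f fg.
by rewrite distrC; apply: cantorC_norm_le => x; exact: fg.
Unshelve. all: by end_near. Qed.

HB.instance Definition _ (R : realType) :=
  Uniform_isComplete.Build (cantorC R) (@cantorC_complete R).

(** The map [A p |-> B p] is well defined, linear and two-sidedly bounded on the
    dense range of [A]; [T] is its continuous extension.  Taking both maps to be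
    parametrized by [P] spares the inversion of [A].  The graph of [T] is the
    closure [G] of the set of pairs [(A p, B p)]; it is total because [W] is
    complete, and functional because it is linear and inherits the bounds. *)
Lemma bounded_below_extension (R : realType) (P : lmodType R)
    (V : normedModType R) (W : completeNormedModType R)
    (A : {linear P -> V}) (B : {linear P -> W}) (k : R) :
  0 < k ->
  (forall p, k^-1 * `|A p| <= `|B p| <= k * `|A p|) ->
  (forall v (e : R), 0 < e -> exists p, `|v - A p| < e) ->
  exists T : {linear V -> W},
    (forall v, k^-1 * `|v| <= `|T v| <= k * `|v|) /\
    forall v, closure (range B) (T v).
Proof.
move=> k0 AB dense.
pose G v w := forall e : R, 0 < e -> exists p, `|v - A p| < e /\ `|w - B p| < e.
have G_total v : exists w, G v w.
  have pos n : 0 < n.+1%:R^-1 :> R by rewrite invr_gt0.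
  have [p pv] := choice (fun n => dense v n.+1%:R^-1 (pos n)).
  have /cvg_ex[w wl] : cvg ((B \o p) n @[n --> \oo]).
    apply: cauchy_cvg; apply/cauchy_ballP => e e0.
    have d0 : 0 < e / (k *+ 2) by rewrite divr_gt0// pmulrn_lgt0.
    rewrite near_map2 -ball_normE /=.
    have small : \forall n \near \oo, `|v - A (p n)| < e / (k *+ 2).
      near=> n; apply: lt_trans (pv n) _; near: n.
      exact: near_infty_natSinv_lt (PosNum d0).
    near=> m n => /=.
    rewrite -linearB; have /andP[_ /le_lt_trans] := AB (p m - p n); apply.
    rewrite linearB mulrC -ltr_pdivlMr//.
    have -> : A (p m) - A (p n) = - (v - A (p m)) + (v - A (p n)).
      by rewrite opprB addrA subrK.
    apply: le_lt_trans (ler_normD _ _) _; rewrite normrN.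
    have -> : e / k = e / (k *+ 2) + e / (k *+ 2) by field; rewrite gt_eqF.
    by apply: ltrD; [near: m|near: n].
  exists w => e e0.
  have [n [n1 n2]] : exists n, `|w - B (p n)| < e /\ n.+1%:R^-1 < e.
    near \oo => n; exists n; split; near: n.
      by move/cvgrPdist_lt : wl; exact.
    exact: near_infty_natSinv_lt (PosNum e0).
  by exists (p n); split=> //; exact: lt_trans (pv n) _.
have G_linear (a : R) u v x y : G u x -> G v y -> G (a *: u + v) (a *: x + y).
  move=> ux vy e e0.
  have a1 : 0 < `|a| + 1 by rewrite ltr_wpDl.
  have d0 : 0 < e / (`|a| + 1) by rewrite divr_gt0.
  have [p [pu px]] := ux _ d0; have [q [qv qy]] := vy _ d0.
  have est (E : normedModType R) (s s' t t' : E) :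
      `|s - s'| < e / (`|a| + 1) -> `|t - t'| < e / (`|a| + 1) ->
      `|a *: s + t - (a *: s' + t')| < e.
    move=> ss tt; rewrite opprD addrACA -scalerBr.
    apply: le_lt_trans (ler_normD _ _) _; rewrite normrZ.
    rewrite [ltRHS](_ : e = `|a| * (e / (`|a| + 1)) + e / (`|a| + 1)).
      by apply: ler_ltD => //; apply: ler_wpM2l => //; exact: ltW.
    by field; rewrite gt_eqF.
  by exists (a *: p + q); rewrite (linearP A) (linearP B); split; apply: est.
have G_bounds v w : G v w -> k^-1 * `|v| <= `|w| <= k * `|v|.
  have k1 : 0 < k^-1 by rewrite invr_gt0.
  move=> vw; apply/andP; split; apply/ler_addgt0Pr => e e0.
    have c0 : 0 < k^-1 + 1 by rewrite addr_gt0.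
    have [p [pv pw]] := vw (e / (k^-1 + 1)) (divr_gt0 e0 c0).
    have eE : k^-1 * (e / (k^-1 + 1)) + e / (k^-1 + 1) = e.
      by rewrite -[X in _ + X]mul1r -mulrDl mulrC divfK// gt_eqF.
    have /andP[ABp _] := AB p.
    have vA := le_trans (lerB_dist _ _) (ltW pv).
    rewrite distrC in pw; have Bw := le_trans (lerB_dist _ _) (ltW pw).
    have : k^-1 * (`|v| - `|A p|) <= k^-1 * (e / (k^-1 + 1)).
      by rewrite ler_pM2l.
    by rewrite mulrBr; move: ABp Bw eE; lra.
  have c0 : 0 < k + 1 by rewrite addr_gt0.
  have [p [pv pw]] := vw (e / (k + 1)) (divr_gt0 e0 c0).
  have eE : k * (e / (k + 1)) + e / (k + 1) = e.
    by rewrite -[X in _ + X]mul1r -mulrDl mulrC divfK// gt_eqF.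
  have /andP[_ ABp] := AB p.
  have wB := le_trans (lerB_dist _ _) (ltW pw).
  rewrite distrC in pv; have Av := le_trans (lerB_dist _ _) (ltW pv).
  have : k * (`|A p| - `|v|) <= k * (e / (k + 1)) by rewrite ler_pM2l.
  by rewrite mulrBr; move: ABp wB eE; lra.
have [T TG] := choice G_total.
have G_fun v x y : G v x -> G v y -> x = y.
  move=> vx vy; have := G_linear (-1) _ _ _ _ vx vy.
  rewrite scaleN1r addNr scaleN1r => /G_bounds/andP[_].
  rewrite normr0 mulr0 normr_le0 addrC subr_eq0 => /eqP //.
have T_lin : linear T by move=> a u v; apply: G_fun (TG _) _; exact: G_linear.
pose T' : {linear V -> W} := HB.pack T (GRing.isLinear.Build R V W *:%R T T_lin).
exists T'; split=> v; first exact: G_bounds.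
move=> U /nbhs_ballP[e /= e0 eU]; have [p [_ pw]] := TG v e e0.
by exists (B p); split; [exists p|apply: eU; rewrite -ball_normE].
Unshelve. all: by end_near. Qed.

(** * The Haar system *)

(** The string [haar_string n] is the entry of index [n] of [haar_strings n.+1],
    and [haar_strings L] is an initial segment of [haar_strings L.+1]; all
    properties of the enumeration are read off from these lists. *)
Definition haar_strings (L : nat) : seq (seq bool) :=
  flatten [seq [seq s <- bin_strings l | haar_index s] | l <- iota 0 L].

Lemma mem_bin_strings n s : (s \in bin_strings n) = (size s == n).
Proof.
elim: n s => [|n IH] s /=; first by case: s.
rewrite mem_cat; case: s => [|b s] /=.
  by apply/negbTE/norP; split; apply/mapP => -[].
rewrite eqSS -IH; have inj c : injective (cons c : seq bool -> _) by move=> ? ? [].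
case: b; rewrite (mem_map (inj _)).
  by case: mapP => [[]|].
by case: (mapP (f := cons true)) => [[]|_]; rewrite ?orbF.
Qed.

Lemma bin_strings_uniq n : uniq (bin_strings n).
Proof.
elim: n => //= n IH; rewrite cat_uniq !map_inj_uniq ?IH/=; last 2 first.
- by move=> ? ? [].
- by move=> ? ? [].
by rewrite andbT; apply/hasPn => _ /mapP[s _ ->]; apply/mapP => -[].
Qed.

Lemma haar_stringsS L : haar_strings L.+1 =
  haar_strings L ++ [seq s <- bin_strings L | haar_index s].
Proof.
by rewrite /haar_strings -addn1 iotaD map_cat flatten_cat/= cats0.
Qed.

Lemma mem_haar_strings L s :
  (s \in haar_strings L) = haar_index s && (size s < L)%N.
Proof.
elim: L => [|L IH]; first by rewrite andbF.
rewrite haar_stringsS mem_cat IH mem_filter mem_bin_strings.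
rewrite ltnS [(size s <= L)%N]leq_eqVlt.
by rewrite -andb_orr orbC.
Qed.

Lemma haar_strings_uniq L : uniq (haar_strings L).
Proof.
elim: L => // L IH; rewrite haar_stringsS cat_uniq IH.
rewrite filter_uniq ?bin_strings_uniq// andbT; apply/hasPn => s.
rewrite mem_filter mem_bin_strings mem_haar_strings => /andP[_ /eqP->].
by rewrite ltnn andbF.
Qed.

Lemma haar_strings_sorted L : sorted leq [seq size s | s <- haar_strings L].
Proof.
rewrite sorted_pairwise; last exact: leq_trans.
elim: L => // L IH; rewrite haar_stringsS map_cat pairwise_cat IH/=.
apply/andP; split.
  apply/allrelP => _ _ /mapP[s sL ->] /mapP[t tL ->].
  move: sL tL; rewrite mem_haar_strings mem_filter mem_bin_strings.
  by move=> /andP[_ /ltnW sL] /andP[_ /eqP ->].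
set l := map _ _; have /all_pred1P -> : all (pred1 L) l.
  apply/allP => _ /mapP[s + ->].
  by rewrite mem_filter mem_bin_strings => /andP[].
elim: (size l) => //= k ->; rewrite andbT.
by apply/allP => n /nseqP[->].
Qed.

Lemma size_haar_strings L : (L <= size (haar_strings L))%N.
Proof.
elim: L => // L IH; rewrite haar_stringsS size_cat -addn1 leq_add//.
have : nseq L false \in [seq s <- bin_strings L | haar_index s].
  rewrite mem_filter mem_bin_strings size_nseq eqxx andbT /haar_index.
  by case: L {IH} => //= L; elim: L.
by case: [seq s <- bin_strings L | haar_index s].
Qed.

Lemma haar_string_nth (n N : nat) : (n < N)%N ->
  haar_string n = nth [::] (haar_strings N) n.
Proof.
rewrite -[haar_string n]/(nth [::] (haar_strings n.+1) n).
elim: N => // N IH; rewrite ltnS leq_eqVlt => /predU1P[->//|nN].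
rewrite IH// [in RHS]haar_stringsS nth_cat ifT//.
exact: leq_trans nN (size_haar_strings N).
Qed.

Lemma haar_string_inj : injective haar_string.
Proof.
move=> m n; have mN : (m < (maxn m n).+1)%N by rewrite ltnS leq_maxl.
have nN : (n < (maxn m n).+1)%N by rewrite ltnS leq_maxr.
rewrite (haar_string_nth mN) (haar_string_nth nN) => /eqP.
rewrite nth_uniq ?haar_strings_uniq// => [/eqP//||].
  exact: leq_trans mN (size_haar_strings _).
exact: leq_trans nN (size_haar_strings _).
Qed.

Lemma haar_string_index n : haar_index (haar_string n).
Proof.
have : haar_string n \in haar_strings n.+1 by exact/mem_nth/size_haar_strings.
by rewrite mem_haar_strings => /andP[].
Qed.

Lemma size_haar_string_mono m n : (m <= n)%N ->
  (size (haar_string m) <= size (haar_string n))%N.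
Proof.
move=> mn; have sn := size_haar_strings n.+1.
rewrite (haar_string_nth (N := n.+1)) ?ltnS//.
rewrite [haar_string n](haar_string_nth (N := n.+1))//.
rewrite -!(nth_map _ 0%N)//; last exact: leq_ltn_trans mn sn.
apply: (sorted_leq_nth leq_trans leqnn 0%N (haar_strings_sorted _)) => //;
  rewrite inE size_map//.
exact: leq_ltn_trans mn sn.
Qed.

Lemma haar_string_surj s : haar_index s -> exists n, haar_string n = s.
Proof.
move=> hs; pose L := (size s).+1.
have sL : s \in haar_strings L by rewrite mem_haar_strings hs /=.
pose n := index s (haar_strings L); exists n.
pose N := maxn L n.+1.
have LN : exists t, haar_strings N = haar_strings L ++ t.
  have : (L <= N)%N by rewrite leq_maxl.
  elim: N => [|N IH]; first by rewrite leqn0 => /eqP ->; exists [::].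
  rewrite leq_eqVlt => /predU1P[<-|/IH[t tE]]; first by exists [::]; rewrite cats0.
  by eexists; rewrite haar_stringsS tE -catA.
have [t tE] := LN.
rewrite (haar_string_nth (N := N)) ?leq_maxr// tE nth_cat index_mem sL.
exact: nth_index.
Qed.

Definition chi (R : realType) (s : seq bool) : cantorC R :=
  mk_cantorC (@indic_cylinder_continuous R s).

Lemma chiE (R : realType) s x :
  cantorC_fun (chi R s) x = (mkseq (x : nat -> bool) (size s) == s)%:R.
Proof.
rewrite -[LHS]/(\1_(cylinder s) x : R) indicE.
suff -> : (x \in cylinder s) = (mkseq (x : nat -> bool) (size s) == s) by [].
by apply/idP/eqP => [/set_mem|?]; [|apply/mem_set].
Qed.

Lemma cantorC_fun_comb (R : realType) (n : nat) (a : 'I_n -> R)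
    (f : 'I_n -> cantorC R) x :
  cantorC_fun (\sum_(i < n) a i *: f i) x = \sum_(i < n) a i * cantorC_fun (f i) x.
Proof. by elim/big_ind2 : _ => // f' u g' v <- <-. Qed.

Lemma mkseq_rcons_eq (x : nat -> bool) s b :
  (mkseq x (size (rcons s b)) == rcons s b) =
  (mkseq x (size s) == s) && (x (size s) == b).
Proof. by rewrite size_rcons mkseqS eqseq_rcons. Qed.

Lemma chi_rcons (R : realType) s :
  chi R s = chi R (rcons s false) + chi R (rcons s true).
Proof.
apply: cantorCP => x.
rewrite -[RHS]/(cantorC_fun (chi R _) x + cantorC_fun (chi R _) x).
rewrite !chiE !mkseq_rcons_eq.
by case: (_ == s); case: (x _); rewrite ?addr0 ?add0r.
Qed.

Definition haar_span (R : realType) (f : cantorC R) : Prop :=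
  exists p, f = comb (@haar R) p.

Lemma haar_spanP (R : realType) (a : R) f g :
  haar_span f -> haar_span g -> haar_span (a *: f + g).
Proof. by move=> [p ->] [q ->]; exists (a *: p + q); rewrite linearP. Qed.

Lemma haar_span_haar (R : realType) n : haar_span (haar R n).
Proof.
exists 'X^n; rewrite (@comb_widen _ _ _ _ n.+1) ?size_polyXn//.
rewrite big_ord_recr/= coefXn eqxx scale1r big1 ?add0r// => i _.
by rewrite coefXn ltn_eqF ?scale0r.
Qed.

(** A string ending in 1 has the indicator of its cylinder expressed through
    shorter strings and a string ending in 0: the cylinder of s1 is the
    complement of that of s0 in the cylinder of s. *)
Lemma haar_span_chi (R : realType) s : haar_span (chi R s).
Proof.
have of_index t : haar_index t -> haar_span (chi R t).
  by move=> /haar_string_surj[n <-]; exact: haar_span_haar.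
elim/last_ind : s => [|s b IH]; first exact: of_index.
case: b; last by apply: of_index; rewrite /haar_index last_rcons.
have -> : chi R (rcons s true) = (-1) *: chi R (rcons s false) + chi R s.
  by rewrite (chi_rcons R s) scaleN1r addKr.
by apply: haar_spanP => //; apply: of_index; rewrite /haar_index last_rcons.
Qed.

Lemma nbhs_cantor_cylinder (x : cantor_space) (U : set cantor_space) :
  nbhs x U -> exists n, forall y : cantor_space,
    mkseq (y : nat -> bool) n = mkseq (x : nat -> bool) n -> U y.
Proof.
move=> xU; apply: contrapT => ncyl.
have /choice[y yP] n : exists y : cantor_space,
    mkseq (y : nat -> bool) n = mkseq (x : nat -> bool) n /\ ~ U y.
  apply: contrapT => ny; apply: ncyl; exists n => y yn.
  by apply: contrapT => nUy; apply: ny; exists y.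
(* Points that agree with x on longer and longer segments converge to x. *)
have yx : {ptws, y @ \oo --> (x : nat -> bool)}.
  apply/pointwise_cvgP => t; apply: cvg_near_cst.
  suff : \forall n \near \oo,
    (y n : nat -> bool) t = (x : nat -> bool) t by [].
  near=> n; have [yn _] := yP n.
  have tn : (t < n)%N by near: n; exact: nbhs_infty_gt.
  by have := congr1 (nth false ^~ t) yn; rewrite !nth_mkseq.
have yU : \forall n \near \oo, U (y n) by exact: (yx _ xU).
have [n] := filter_ex yU.
by have [] := yP n.
Unshelve. all: by end_near. Qed.

(** Call a string good if on its cylinder [f] is within [e / 2] of an element of
    the span vanishing off the cylinder.  If both one-letter extensions of a
    string are good, so is the string: add the two approximations, whose
    supports are disjoint.  So if the empty string is bad, there is a point [x]
    all of whose initial segments are bad; but by continuity the constant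
    [f x] is a good approximation on a small cylinder around [x]. *)
Lemma haar_dense (R : realType) (f : cantorC R) (e : R) : 0 < e ->
  exists p, `|f - comb (@haar R) p| < e.
Proof.
move=> e0; have e2 : 0 < e / 2 by rewrite divr_gt0.
pose good s := exists g, haar_span g /\ forall x : cantor_space,
  if mkseq (x : nat -> bool) (size s) == s
  then (`|cantorC_fun f x - cantorC_fun g x| <= e / 2 : Prop)
  else cantorC_fun g x = 0.
have good_split s : good (rcons s false) -> good (rcons s true) -> good s.
  move=> [g [gs gP]] [h [hs hP]]; exists (g + h); split.
    by rewrite -[g]scale1r; exact: haar_spanP.
  move=> x; have := gP x; have := hP x; rewrite !mkseq_rcons_eq.
  rewrite -[cantorC_fun (g + h) x]/(cantorC_fun g x + cantorC_fun h x).
  case: (mkseq _ _ == s) => /=; last by move=> -> ->; rewrite addr0.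
  case: (x (size s)) => /=; last by move=> -> ?; rewrite addr0.
  by move=> + ->; rewrite add0r.
have [[g [[p ->] gP]]|bad] := pselect (good [::]).
  exists p; apply: (@le_lt_trans _ _ (e / 2)); last by lra.
  by apply: cantorC_norm_le => x; have := gP x.
pose next (s : seq bool) :=
  if pselect (good (rcons s false)) then rcons s true else rcons s false.
have next_bad s : ~ good s -> ~ good (next s).
  move=> bs; rewrite /next; case: pselect => //= gf gt; exact/bs/good_split.
pose u n := iter n next [::].
have u_bad n : ~ good (u n) by elim: n => //= n; exact: next_bad.
have uS n : exists b, u n.+1 = rcons (u n) b.
  by rewrite /= /next; case: pselect; eexists.
pose x : cantor_space := fun n => last false (u n.+1).
have ux n : mkseq (x : nat -> bool) n = u n.
  elim: n => // n IH; rewrite mkseqS IH /x; have [b ->] := uS n.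
  by rewrite last_rcons.
have su n : size (u n) = n by rewrite -ux size_mkseq.
exfalso.
(* Near x, the function f is almost constant on some cylinder u n. *)
have := @cantorC_continuous R f x.
move=> /cvgrPdist_le/(_ _ e2) fx.
suff [n nP] : exists n, forall y : cantor_space,
    mkseq (y : nat -> bool) n = u n ->
    `|cantorC_fun f x - cantorC_fun f y| <= e / 2.
  apply: (u_bad n); exists (cantorC_fun f x *: chi R (u n)); split.
    rewrite -[X in haar_span X]addr0; apply: haar_spanP; first exact: haar_span_chi.
    by exists 0; rewrite linear0.
  move=> y; rewrite -[cantorC_fun (_ *: _) y]/(_ * cantorC_fun (chi R (u n)) y).
  rewrite chiE su.
  case: eqP => [yn|_]; last by rewrite mulr0.
  by rewrite mulr1 distrC nP.
have [n nP] := nbhs_cantor_cylinder fx.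
by exists n => y yn; apply: nP; rewrite ux.
Qed.

(** The last coefficient vanishes, by comparing two points.  Let s0 be the last
    string involved.  The points s0000... and s1000... first differ at the
    last letter of s0; an earlier string is not longer, so it cannot separate
    them unless it is s0 or s1.  It is not s0 as the enumeration is injective,
    nor s1 as enumerated nonempty strings end in 0.  Hence the two values of the
    combination differ by the last coefficient. *)
Lemma haar_free (R : realType) (m : nat) (a : nat -> R) :
  \sum_(i < m) a i *: haar R i = 0 -> forall i, (i < m)%N -> a i = 0.
Proof.
elim: m => // m IH sum0.
have am0 : a m = 0.
  have eval x : \sum_(i < m) a i * cantorC_fun (haar R i) x +
      a m * cantorC_fun (haar R m) x = 0.
    rewrite -[RHS]/(cantorC_fun (0 : cantorC R) x) -sum0 cantorC_fun_comb.
    by rewrite big_ord_recr.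
  have := haar_string_index m; case tE : (haar_string m) / lastP => [|s b].
    (* Only the index 0 has the empty string, whose function is 1. *)
    have m0 : m = 0%N by apply: haar_string_inj; rewrite tE.
    move: (eval point); rewrite m0 big_ord0 add0r.
    by rewrite -[haar R 0]/(chi R (haar_string 0)) chiE mulr1.
  rewrite /haar_index last_rcons => /negbTE bF; rewrite bF in tE.
  pose x c : cantor_space := nth false (rcons s c).
  have same (i : 'I_m) :
      cantorC_fun (haar R i) (x true) = cantorC_fun (haar R i) (x false).
    rewrite -[haar R i]/(chi R (haar_string i)) !chiE; congr (_%:R).
    have := size_haar_string_mono (ltnW (ltn_ord i)).
    rewrite tE size_rcons => si.
    have xE c : mkseq (x c : nat -> bool) (size (haar_string i)) =
        take (size (haar_string i)) (rcons s c).
      by apply: map_nth_iota0; rewrite size_rcons.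
    rewrite !xE; move: si; rewrite leq_eqVlt => /predU1P[si|].
      rewrite si -(size_rcons s true) take_size (size_rcons s true).
      rewrite -(size_rcons s false) take_size.
      have /negbTE -> : rcons s true != haar_string i.
        apply/eqP => E; have := haar_string_index i.
        by rewrite -E /haar_index last_rcons.
      have /negbTE -> // : rcons s false != haar_string i.
      rewrite -tE; apply/eqP => /haar_string_inj E.
      by have := ltn_ord i; rewrite -E ltnn.
    by rewrite ltnS => si; rewrite -!cats1 !takel_cat.
  have := eval (x true); rewrite (eq_bigr _ (fun i _ => congr1 _ (same i))).
  have := eval (x false).
  rewrite -[haar R m]/(chi R (haar_string m)) !chiE tE !mkseq_rcons_eq.
  have xs c : mkseq (x c : nat -> bool) (size s) = s.
    apply: (@eq_from_nth _ false); rewrite size_mkseq// => i il.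
    by rewrite nth_mkseq// /x nth_rcons il.
  rewrite !xs eqxx /= /x !nth_rcons ltnn eqxx /= mulr1 mulr0 addr0.
  by move=> + s0; rewrite s0 add0r.
move=> i; rewrite ltnS leq_eqVlt => /predU1P[->//|]; apply: IH.
by move: sum0; rewrite big_ord_recr/= am0 scale0r addr0.
Qed.

Lemma haar_lin_indep (R : realType) (m : nat) :
  lin_indep (fun i : 'I_m => haar R i).
Proof.
move=> a sum0 i; pose b (j : nat) : R := if insub j is Some k then a k else 0.
have bE (j : 'I_m) : b j = a j by rewrite /b valK.
rewrite -bE; apply: (@haar_free R m) => //.
by rewrite -[RHS]sum0; apply: eq_bigr => j _; rewrite bE.
Qed.

(** * The non-universal tree *)

Lemma equivalent_seqs_sym (R : realType) (V W : normedModType R) (C : R)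
    (m : nat) (x : 'I_m -> V) (y : 'I_m -> W) :
  0 < C -> equivalent_seqs C x y -> equivalent_seqs C y x.
Proof.
move=> C0 xy a; have /andP[lo hi] := xy a.
by rewrite ler_pdivrMl// hi -ler_pdivrMl// lo.
Qed.

Lemma equivalent_seqs_take (R : realType) (V W : normedModType R) (C : R)
    (n m : nat) (x : nat -> V) (y : nat -> W) :
  (n <= m)%N -> @equivalent_seqs R V W C m (fun i => x i) (fun i => y i) ->
  @equivalent_seqs R V W C n (fun i => x i) (fun i => y i).
Proof.
move=> nm eq_m a.
pose b (i : nat) : R := if insub i is Some j then a j else 0.
have bE (E : lmodType R) (z : nat -> E) :
    \sum_(i < n) a i *: z i = \sum_(i < m) b i *: z i.
  rewrite (bigID (fun i : 'I_m => (i < n)%N))/= [X in _ = _ + X]big1 ?addr0.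
    rewrite -(big_ord_widen m (fun i => b i *: z i) nm).
    by apply: eq_bigr => i _; rewrite /b valK.
  by move=> i ni; rewrite /b insubF ?scale0r//; exact: negbTE.
by rewrite !bE; exact: eq_m.
Qed.

(** The nodes in functional form, which avoids index types that depend on the
    length of a list. *)
Lemma NU_tree_mkseq (R : realType) (V Z : normedModType R) (x : nat -> V)
    (e : nat -> Z) (k m : nat) (l : nat -> nat) :
  NU_tree x e (k :: mkseq l m) <->
  (1 <= k)%N /\
  @equivalent_seqs R V Z k%:R m (fun i => x (l i)) (fun i => e i).
Proof.
rewrite /NU_tree /= size_mkseq.
suff -> : (fun i : 'I_m => x (nth 0%N (mkseq l m) i)) = (fun i => x (l i)) by [].
by apply: funext => i; rewrite nth_mkseq.
Qed.

Lemma NU_tree_prefix_closed (R : realType) (V Z : normedModType R)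
    (x : nat -> V) (e : nat -> Z) : prefix_closed (NU_tree x e).
Proof.
move=> [//|k s] [//|k' t]; rewrite prefix_cons => /andP[/eqP <- st] [k1 eq_t].
split=> //.
have := equivalent_seqs_take (x := fun i => x (nth 0%N t i)) (size_prefix st) eq_t.
move/prefixP : st => [u ->].
suff -> : (fun i : 'I_(size s) => x (nth 0%N (s ++ u) i)) =
          (fun i => x (nth 0%N s i)) by [].
by apply: funext => i; rewrite nth_cat ltn_ord.
Qed.

Lemma NU_tree_branch (R : realType) (V Z : normedModType R)
    (x : nat -> V) (e : nat -> Z) (b : nat -> nat) :
  infinite_branch (NU_tree x e) b ->
  (1 <= b 0)%N /\
  forall m, @equivalent_seqs R V Z (b 0%N)%:R m
    (fun i => x (b i.+1)) (fun i => e i).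
Proof.
move=> xb.
have mem m : NU_tree x e (b 0%N :: mkseq (fun i => b i.+1) m).
  have := xb m.+1; rewrite /mkseq /= [iota 1 m](iotaDl 1 0 m) -map_comp.
  exact.
split; first by have /NU_tree_mkseq[] := mem 0%N.
by move=> m; have /NU_tree_mkseq[] := mem m.
Qed.

Lemma SB_comb (R : realType) (X : SB R) (x : nat -> cantorC R) (p : {poly R}) :
  (forall n, SB_set X (x n)) -> SB_set X (comb x p).
Proof.
move=> xX; have X0 := SB_zero X.
apply: big_ind => // [f g fX gX|i _].
  by rewrite -[f]scale1r; exact: SB_linear.
by rewrite -[_ *: _]addr0; exact: SB_linear.
Qed.

(** The constant of all the equivalences along a branch is its first entry, so it
    is uniform in the length: that is why the entry k is part of the nodes. *)
Lemma branch_contains_copy (R : realType) (X : SB R) (x : nat -> cantorC R)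
    (b : nat -> nat) :
  (forall n, SB_set X (x n)) -> infinite_branch (NU_tree x (@haar R)) b ->
  contains_copy (cantorC R) (SB_set X).
Proof.
move=> xX /NU_tree_branch[b1 eq_b].
have k0 : 0 < (b 0%N)%:R :> R by rewrite ltr0n.
have AB p : (b 0%N)%:R^-1 * `|comb (@haar R) p| <= `|comb (fun i => x (b i.+1)) p|
    <= (b 0%N)%:R * `|comb (@haar R) p|.
  exact: (equivalent_seqs_sym k0 (eq_b (size p)) (fun i => p`_i)).
have [T [T_bounds T_closure]] := bounded_below_extension k0 AB (@haar_dense R).
exists T, (b 0%N)%:R; split=> // v.
rewrite ((closure_id _).1 (@SB_closed _ X)).
apply: closure_subset (T_closure v) => _ [p _ <-].
exact: SB_comb.
Qed.

Lemma NU_tree_unbounded (R : realType) (X : SB R) (x : nat -> cantorC R) :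
  ~ finite_dimensional (SB_set X) -> SB_set X `<=` closure (range x) ->
  forall n, exists2 t, NU_tree x (@haar R) t & size t = n.
Proof.
move=> Xinf xdense [|m]; first by exists [::].
have [y yX y_indep] :=
  infinite_dim_lin_indep (SB_zero X) (@SB_linear _ X) Xinf m.
have [e e0 near_indep] := lin_indep_perturb y_indep.
have /choice[l lP] i : exists n, forall im : (i < m)%N,
    `|y (Ordinal im) - x n| < e.
  have [im|mi] := pselect (i < m)%N; last by exists 0%N.
  have [_ [[n _ <-]]] := xdense _ (yX (Ordinal im)) _ (nbhsx_ballx _ _ e0).
  rewrite -ball_normE /= => yn; exists n => im'.
  by rewrite (bool_irrelevance im' im).
have l_indep : lin_indep (fun i : 'I_m => x (l i)).
  by apply: near_indep => -[i im]; exact: lP.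
have [k k1 eq_k] := lin_indep_equivalent l_indep (@haar_lin_indep R m).
exists (k :: mkseq l m); first exact/NU_tree_mkseq.
by rewrite /= size_mkseq.
Qed.

Theorem theorem6 (R : realType) (d : nat -> SB R -> cantorC R)
    (d_borel : forall n, borel_SB_map (d n))
    (d_in : forall (X : SB R) n, SB_set X (d n X))
    (d_dense : forall X : SB R, SB_set X `<=` closure (range (fun n => d n X)))
    (X : SB R) (X_NU : NU X) (X_inf : ~ finite_dimensional (SB_set X)) :
  ole (OSucc oomega) (tree_order (T_NU d X)).
Proof.
have T_closed : prefix_closed (T_NU d X) by exact: NU_tree_prefix_closed.
apply: tree_order_gt => //.
  by case=> b /(branch_contains_copy (d_in X)); exact: X_NU.
by apply: root_in_omega_derivative => //; exact: NU_tree_unbounded (d_dense X).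
Qed.
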